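(* Let $G$ be a connected real linear semisimple Lie group, and let $\Gamma\subset G$ be a Zariski dense subgroup. Then all non-trivial normal subgroups $\Gamma'\triangleleft\Gamma$ are Zariski dense in $G$ if and only if $\Gamma$ is normally irreducible.
   Context: A subgroup $\Gamma\subset G$ is normally irreducible if $N\cap\Gamma=\{\mathrm{Id}\}$ for every normal subgroup $N\triangleleft G$ with $N\ne G$. *)

(* Defs.v *)
From HB Require Import structures.
From mathcomp Require Import all_boot all_order all_algebra.
From mathcomp Require Import all_classical all_reals all_analysis.
(* Not imported: the notations of mpoly clash with those of MathComp-Analysis. *)
From mathcomp Require mpoly.

Set Implicit Arguments.
Unset Strict Implicit.
Unset Printing Implicit Defensive.

Import Order.TTheory GRing.Theory Num.Theory.
Import numFieldNormedType.Exports.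

Local Open Scope classical_set_scope.
Local Open Scope ring_scope.

Section Groups.
Variables (R : realType) (n : nat).
Implicit Types (G H N : set 'M[R]_n).

Definition GL : set 'M[R]_n := [set X | X \in unitmx].

Definition is_group G : Prop :=
  [/\ G `<=` GL, G 1%:M,
      forall X Y, G X -> G Y -> G (X *m Y)
    & forall X, G X -> G (invmx X)].

Definition subgroup H G : Prop := is_group H /\ H `<=` G.

Definition normal_subgroup N G : Prop :=
  subgroup N G /\ forall X Y, G X -> N Y -> N (X *m Y *m invmx X).

(* N ranges over all abstract normal subgroups of G, not only the closed or
   connected ones. *)
Definition normally_irreducible H G : Prop :=
  forall N, normal_subgroup N G -> N <> G -> N `&` H = [set 1%:M].

End Groups.

Section ZariskiTopology.
Variables (R : realType) (n : nat).
Implicit Types (S G Z : set 'M[R]_n).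

(* Polynomials in the n * n matrix entries; on GL the inverse of the
   determinant need not be adjoined, as it does not change the closed sets. *)
Definition zariski_closed Z : Prop :=
  exists P : set (mpoly.mpoly (n * n) R),
    Z = [set X | forall p, P p -> mpoly.meval (fun i => mxvec X 0 i) p = 0].

Definition zariski_closure S : set 'M[R]_n :=
  \bigcap_(Z in [set Z | zariski_closed Z /\ S `<=` Z]) Z.

Definition zariski_dense S G : Prop := S `<=` G /\ G `<=` zariski_closure S.

End ZariskiTopology.

Section LieAlgebras.
Variables (R : realType) (n : nat).
Implicit Types (L I : {vspace 'M[R]_n}).

Definition lie_bracket (X Y : 'M[R]_n) : 'M[R]_n := X *m Y - Y *m X.

Definition lie_ideal I L : Prop :=
  (I <= L)%VS /\ forall X Y, X \in L -> Y \in I -> lie_bracket X Y \in I.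

Definition lie_abelian L : Prop :=
  forall X Y, X \in L -> Y \in L -> lie_bracket X Y = 0.

Definition lie_simple L : Prop :=
  ~ lie_abelian L /\ forall I, lie_ideal I L -> I = 0%VS \/ I = L.

(* L is a (possibly empty) direct sum of simple ideals; this forces L to be
   closed under the bracket. *)
Definition lie_semisimple L : Prop :=
  exists (k : nat) (I : 'I_k -> {vspace 'M[R]_n}),
    [/\ L = (\sum_(i < k) I i)%VS,
        directv (\sum_(i < k) I i)%VS
      & forall i, lie_ideal (I i) L /\ lie_simple (I i)].

End LieAlgebras.

Section LinearLieGroups.
Variables (R : realType) (n : nat).
Implicit Types (G : set 'M[R]_n).

Definition expmx (X : 'M[R]_n) : 'M[R]_n :=
  limn (series (fun k : nat => (k`!%:R)^-1 *: X ^+ k)).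

Definition lie_algebra G : set 'M[R]_n :=
  [set X | forall t : R, G (expmx (t *: X))].

(* A closed (for the usual topology) subgroup of GL_n(R). *)
Definition linear_lie_group G : Prop :=
  is_group G /\ closure G `&` @GL R n `<=` G.

(* The Lie algebra of a linear Lie group is a linear subspace, so the
   subspace L always exists and is unique. *)
Definition semisimple_lie_group G : Prop :=
  exists L : {vspace 'M[R]_n},
    lie_algebra G = [set X | X \in L] /\ lie_semisimple L.

End LinearLieGroups.

(* Main.v *)
From HB Require Import structures.
From mathcomp Require Import all_boot all_order all_algebra.
From mathcomp Require Import all_classical all_reals all_analysis.
From mathcomp Require mpoly.
Import (canonicals) mpoly.
From mathcomp Require Import ring.
Require Import Defs.
Set Implicit Arguments.
Unset Strict Implicit.
Unset Printing Implicit Defensive.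
Import Order.TTheory GRing.Theory Num.Theory.
Import numFieldNormedType.Exports.
Local Open Scope classical_set_scope.
Local Open Scope ring_scope.

(** Let N be the intersection with G of the Zariski closure of a nontrivial
    normal subgroup of Gamma; as Gamma is dense and normalises it, so does G.
    Hence if Gamma is normally irreducible then N, which meets Gamma
    nontrivially, is all of G. To avoid showing that the closure of a group is
    closed under inverses, N is replaced by the stabiliser of the closure under
    left translation, which is a group by construction
    ([closure_stabilizer_normal], [normally_irreducible_dense]).

    Conversely, if a proper normal subgroup N of G met Gamma nontrivially, the
    intersection would be normal in Gamma, hence dense, and N would be a dense
    normal subgroup. So the point is that an abstract normal subgroup N of G
    which is Zariski dense is the whole of G ([dense_normal_full]). Let L be the
    Lie algebra of G.

    - The vectors X - h X h^-1, with X in L and h in N, span a space V that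
      contains L. Indeed X - g X g^-1 lies in V for all g in N, hence for all
      g in G because this is a Zariski closed condition; differentiating along
      exp (t Y) shows that V contains the brackets of L, and a semisimple
      L is spanned by its brackets ([dense_normal_span]).
    - Each X - h X h^-1 is the velocity at 0 of the curve
      exp (t X) h exp (- t X) h^-1, which stays inside N because N is
      normal. A product of such curves, followed by the exponential
      on a complement of L, is therefore a map from matrices to matrices whose
      derivative at 0 is the identity, and by the inverse function theorem it
      covers a neighbourhood of 1 ([strict_diff0_locally_onto]).
    - For g in G close to 1 this writes g as an element of N times exp m, with m
      small in the complement of L. Then exp m lies in G, and the argument of
      Cartan's closed subgroup theorem forces m = 0
      ([exp_transversal_trivial]).

    So N contains a neighbourhood of 1 in G, and N = G since G is connected.

    Differentiability at 0 is used in its strict form throughout: it is stable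
    under products, holds for the exponential by a direct estimate on its series,
    and is exactly what the contraction argument of the inverse function theorem
    consumes. *)

(** * The sup norm of a matrix product *)

Section MatrixNorm.
Variables (R : realType) (n : nat).
Implicit Types (X Y A B : 'M[R]_n).

Lemma mx_norm_entry m p (X : 'M[R]_(m, p)) i j : `|X i j| <= `|X|.
Proof.
rewrite [leRHS]/Num.norm /= mx_normrE.
by apply/bigmax_geP; right => /=; exists (i, j).
Qed.

Lemma mx_norm_le m p (X : 'M[R]_(m, p)) (c : R) :
  0 <= c -> (forall i j, `|X i j| <= c) -> `|X| <= c.
Proof.
move=> c0 Xc; rewrite [leLHS]/Num.norm /= mx_normrE.
by apply/bigmax_leP; split => // -[i j] _; apply: Xc.
Qed.

Lemma mx_norm_mul X Y : `|X *m Y| <= n.+1%:R * `|X| * `|Y|.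
Proof.
apply: mx_norm_le => [|i j]; first by rewrite !mulr_ge0.
rewrite mxE (le_trans (ler_norm_sum _ _ _))//.
apply: (@le_trans _ _ (\sum_(k < n) (`|X| * `|Y|))).
  by apply: ler_sum => k _; rewrite normrM ler_pM ?mx_norm_entry.
rewrite sumr_const card_ord -[leLHS]mulr_natl -mulrA ler_wpM2r ?mulr_ge0//.
by rewrite ler_nat.
Qed.

(** The factor makes the sup norm submultiplicative, which lets series of
    matrices be compared term by term with real series. *)
Definition snorm X : R := n.+1%:R * `|X|.

Lemma snorm_ge0 X : 0 <= snorm X. Proof. exact: mulr_ge0. Qed.

Lemma snormM X Y : snorm (X *m Y) <= snorm X * snorm Y.
Proof.
apply: le_trans (ler_wpM2l _ (mx_norm_mul X Y)) _ => //.
by rewrite /snorm [leRHS](_ : _ = n.+1%:R * (n.+1%:R * `|X| * `|Y|)) //; ring.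
Qed.

Lemma snormD X Y : snorm (X + Y) <= snorm X + snorm Y.
Proof. by rewrite -mulrDr ler_wpM2l ?ler_normD. Qed.

Lemma snormZ (a : R) X : snorm (a *: X) = `|a| * snorm X.
Proof. by rewrite /snorm normrZ mulrCA. Qed.

Lemma norm_le_snorm X : `|X| <= snorm X.
Proof. by rewrite ler_peMl// ler1n. Qed.

Lemma snorm_sum I (s : seq I) (P : pred I) (F : I -> 'M[R]_n) :
  snorm (\sum_(i <- s | P i) F i) <= \sum_(i <- s | P i) snorm (F i).
Proof.
by rewrite /snorm -mulr_sumr ler_wpM2l ?ler_norm_sum.
Qed.

Lemma snormXS X k : snorm (X ^+ k.+1) <= snorm X ^+ k.+1.
Proof.
elim: k => [|k IHk]; first by rewrite !expr1.
by rewrite exprS [leRHS]exprS (le_trans (snormM _ _)) ?ler_wpM2l ?snorm_ge0.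
Qed.

Lemma norm_mx1 : `|1%:M : 'M[R]_n| <= 1.
Proof.
by apply: mx_norm_le => // i j; rewrite mxE; case: eqP; rewrite ?normr1 ?normr0.
Qed.

Lemma normX_snorm X k : `|X ^+ k| <= snorm X ^+ k.
Proof.
case: k => [|k]; first by rewrite !expr0 norm_mx1.
exact: le_trans (norm_le_snorm _) (snormXS _ _).
Qed.

Lemma snormX_lip X Y (r : R) k : snorm X <= r -> snorm Y <= r ->
  snorm (X ^+ k.+1 - Y ^+ k.+1) <= k.+1%:R * r ^+ k * snorm (X - Y).
Proof.
move=> Xr Yr; have r0 : 0 <= r := le_trans (snorm_ge0 X) Xr.
elim: k => [|k IHk]; first by rewrite !expr1 expr0 mulr1 mul1r.
have -> : X ^+ k.+2 - Y ^+ k.+2 =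
    X *m (X ^+ k.+1 - Y ^+ k.+1) + (X - Y) *m Y ^+ k.+1.
  by rewrite !exprS mulmxBr mulmxBl addrA subrK.
rewrite (le_trans (snormD _ _))// -[k.+2%:R]natr1 mulrDl mulrDl mul1r lerD//.
  rewrite (le_trans (snormM _ _))//.
  rewrite [leRHS](_ : _ = r * (k.+1%:R * r ^+ k * snorm (X - Y))).
    by rewrite ler_pM ?snorm_ge0.
  by rewrite exprS; ring.
rewrite (le_trans (snormM _ _))// mulrC ler_wpM2r ?snorm_ge0//.
by rewrite (le_trans (snormXS _ _))// lerXn2r ?nnegrE ?snorm_ge0.
Qed.

(** In finite dimension every linear map is bounded: expand X on the elementary
    matrices. *)
Lemma mx_linear_bounded (V : normedModType R) (f : {linear 'M[R]_n -> V}) :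
  exists2 K : R, 0 <= K & forall X, `|f X| <= K * `|X|.
Proof.
exists (\sum_i \sum_j `|f (delta_mx i j)|) => [|X].
  by apply: sumr_ge0 => i _; apply: sumr_ge0.
rewrite {1}(matrix_sum_delta X) linear_sum mulr_suml.
rewrite (le_trans (ler_norm_sum _ _ _))//; apply: ler_sum => i _.
rewrite linear_sum mulr_suml (le_trans (ler_norm_sum _ _ _))//.
apply: ler_sum => j _; rewrite linearZ normrZ mulrC.
by rewrite ler_wpM2l ?mx_norm_entry.
Qed.

Lemma cvg_mulmx (u v : nat -> 'M[R]_n) A B :
  u @ \oo --> A -> v @ \oo --> B -> (fun k => u k *m v k) @ \oo --> A *m B.
Proof.
move=> uA vB; apply/subr_cvg0/norm_cvg0P.
have uA0 : (fun k => `|u k - A|) @ \oo --> (0 : R).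
  by apply/norm_cvg0P/subr_cvg0.
have vB0 : (fun k => `|v k - B|) @ \oo --> (0 : R).
  by apply/norm_cvg0P/subr_cvg0.
pose w k : R := n.+1%:R * `|u k - A| * `|v k| + n.+1%:R * `|A| * `|v k - B|.
apply: (@squeeze_cvgr _ _ _ _ (fun=> 0) w).
- apply: nearW => k; rewrite normr_ge0 /w.
  have -> : u k *m v k - A *m B = (u k - A) *m v k + A *m (v k - B).
    by rewrite mulmxBl mulmxBr addrA subrK.
  by rewrite (le_trans (ler_normD _ _))// lerD// mx_norm_mul.
- exact: cvg_cst.
- have -> : 0 = n.+1%:R * 0 * `|B| + n.+1%:R * `|A| * 0 :> R.
    by rewrite !mulr0 mul0r addr0.
  apply: cvgD; apply: cvgM => //; first by apply: cvgM => //; exact: cvg_cst.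
    exact: cvg_norm.
  exact: cvg_cst.
Qed.

End MatrixNorm.

(** * The matrix exponential *)

Section Triangle.
Variable V : zmodType.

Lemma triangle_sum (f : nat -> nat -> V) m :
  \sum_(k < m) \sum_(i < k.+1) f i (k - i)%N =
  \sum_(i < m) \sum_(j < m - i) f i j.
Proof.
elim: m => [|m IHm]; first by rewrite !big_ord0.
rewrite [RHS]big_ord_recr /= subSnn big_ord1.
rewrite big_ord_recr /= IHm big_ord_recr /= subnn addrA; congr (_ + _).
rewrite -big_split; apply: eq_bigr => i _ /=.
by rewrite subSn ?[in RHS]big_ord_recr // ltnW.
Qed.

(** The error made when the square of a Cauchy product is cut along its
    antidiagonal. Stating it for any summand allows the same identity to be used
    for matrices and for the real series that dominates them. *)
Lemma square_sub_triangle (f : nat -> nat -> V) m :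
  \sum_(i < m) \sum_(j < m) f i j - \sum_(k < m) \sum_(i < k.+1) f i (k - i)%N =
  \sum_(i < m) \sum_(m - i <= j < m) f i j.
Proof.
rewrite triangle_sum -sumrB; apply: eq_bigr => i _.
rewrite -(big_mkord predT (f i)) -(big_mkord predT (f i)).
by rewrite (big_cat_nat (leq0n _) (leq_subr i m)) //= addrAC subrr add0r.
Qed.

End Triangle.

Section Exponential.
Variables (R : realType) (n : nat).
Implicit Types (X Y A B : 'M[R]_n).

Definition exp_term X (k : nat) : 'M[R]_n := (k`!%:R)^-1 *: X ^+ k.

Lemma exp_coeff_series_le (r : R) m : 0 <= r ->
  series (exp_coeff r) m <= expR r.
Proof.
move=> r0; apply: nondecreasing_cvgn_le; last exact: is_cvg_series_exp_coeff.
by apply: nondecreasing_series => k _ _; apply: exp_coeff_ge0.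
Qed.

Lemma cvg_expmx X : series (exp_term X) @ \oo --> expmx X.
Proof.
suff: cvgn (series (exp_term X)) by [].
have: cvgn (series (exp_coeff (snorm X))) by exact: is_cvg_series_exp_coeff.
move=> /cauchy_cvgP/cauchy_seriesP cX.
apply/cauchy_cvgP/cauchy_seriesP => e /cX; apply: filterS => -[a b] /=.
rewrite ger0_norm; last by apply: sumr_ge0 => k _; exact: exp_coeff_ge0 (snorm_ge0 X).
apply: le_lt_trans; apply: le_trans (ler_norm_sum _ _ _) _.
apply: ler_sum => k _; rewrite /exp_term /exp_coeff normrZ ger0_norm //= mulrC.
by rewrite ler_wpM2r // normX_snorm.
Qed.

Lemma norm_cvg_le (V : normedModType R) (u : nat -> V) l (c : R) :
  u @ \oo --> l -> (forall k, `|u k| <= c) -> `|l| <= c.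
Proof.
move=> ul uc; rewrite leNgt; apply/negP => cl.
have [N _ /(_ N (leqnn N))] : \forall k \near \oo, c < `|u k| by exact: cvgr_norm_gt cl.
by rewrite /= ltNge uc.
Qed.

(** The exponential is strictly tangent to the identity at 0. The terms of degree
    0 and 1 cancel, and the term of degree k + 2 is at most
    r^(k+1) / (k+1)! times the norm of X - Y. *)
Lemma expmx_sub_id X Y (r : R) : snorm X <= r -> snorm Y <= r ->
  `|expmx X - expmx Y - (X - Y)| <= (expR r - 1) * snorm (X - Y).
Proof.
move=> Xr Yr; have r0 : 0 <= r := le_trans (snorm_ge0 X) Xr.
pose u m := series (exp_term X) (m + 2)%N - series (exp_term Y) (m + 2)%N - (X - Y).
apply: (@norm_cvg_le _ u).
  apply: cvgB; last exact: cvg_cst.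
  by apply: cvgB; rewrite cvg_shiftn; exact: cvg_expmx.
move=> m; apply: le_trans (norm_le_snorm _) _.
have -> : u m = \sum_(k < m) ((k.+2)`!%:R)^-1 *: (X ^+ k.+2 - Y ^+ k.+2).
  rewrite /u /series /= addn2 !big_mkord !(big_ord_recl m.+1) !(big_ord_recl m) /=.
  rewrite /exp_term /bump /= !expr0 !expr1 invr1 !scale1r.
  under [in RHS]eq_bigr do rewrite scalerBr.
  rewrite sumrB /bump /=.
  set s := \sum_(_ < _) _; set t := \sum_(_ < _) _.
  by apply/matrixP => i j; rewrite !mxE; ring.
apply: le_trans (snorm_sum _ _ _) _.
apply: (@le_trans _ _ ((series (exp_coeff r) m.+1 - 1) * snorm (X - Y))); last first.
  by rewrite ler_wpM2r ?snorm_ge0 // lerB // exp_coeff_series_le.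
rewrite /series /= big_mkord big_ord_recl /exp_coeff /= expr0 mul1r invr1 addrAC.
rewrite subrr add0r mulr_suml; apply: ler_sum => k _.
rewrite snormZ ger0_norm // /bump /= add1n.
apply: le_trans (ler_wpM2l _ (snormX_lip _ Xr Yr)) _ => //.
rewrite [leLHS](_ : _ = r ^+ k.+1 / (k.+1)`!%:R * snorm (X - Y)) //.
rewrite (factS k.+1) natrM; field.
by rewrite -natrD !pnatr_eq0 -lt0n fact_gt0.
Qed.

Lemma expmx0 : expmx (0 : 'M[R]_n) = 1%:M.
Proof.
have h : series (exp_term 0) @ \oo --> (1%:M : 'M[R]_n).
  rewrite -(cvg_shiftn 1).
  suff -> : (fun k => series (exp_term 0) (k + 1)%N) = fun=> 1%:M by exact: cvg_cst.
  apply/funext => k; rewrite /series /= addn1 big_mkord big_ord_recl /exp_term /=.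
  rewrite invr1 scale1r expr0 big1 ?addr0 // => i _.
  by rewrite exprS mul0r scaler0.
by apply: cvg_lim h; exact: norm_hausdorff.
Qed.

Lemma expmx_lip X Y (r : R) : snorm X <= r -> snorm Y <= r ->
  `|expmx X - expmx Y| <= expR r * snorm (X - Y).
Proof.
move=> Xr Yr; rewrite -[X in `|X|](subrK (X - Y)) (le_trans (ler_normD _ _)) //.
rewrite -[expR r](subrK 1) mulrDl mul1r lerD ?norm_le_snorm //.
exact: expmx_sub_id.
Qed.

Lemma norm_mulX_snorm A B j i :
  `|A ^+ j *m B ^+ i| <= snorm A ^+ j * snorm B ^+ i.
Proof.
case: j => [|j]; first by rewrite !expr0 mul1r mul1mx normX_snorm.
case: i => [|i]; first by rewrite !expr0 mulr1 mulmx1 normX_snorm.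
rewrite (le_trans (norm_le_snorm _)) // (le_trans (snormM _ _)) //.
by rewrite ler_pM ?snorm_ge0 ?snormXS.
Qed.

Lemma fact_binomial k (i : 'I_k.+1) :
  (k`!%:R)^-1 * ('C(k, i))%:R = ((k - i)%N`!%:R)^-1 * (i`!%:R)^-1 :> R.
Proof.
have ik : (i <= k)%N by rewrite -ltnS.
rewrite -(bin_fact ik) !natrM; field.
by rewrite !pnatr_eq0 -!lt0n bin_gt0 ik !fact_gt0.
Qed.

Lemma exp_termD A B k : A *m B = B *m A ->
  exp_term (A + B) k = \sum_(i < k.+1) exp_term A (k - i)%N *m exp_term B i.
Proof.
move=> cAB; rewrite /exp_term exprDn_comm // scaler_sumr; apply: eq_bigr => i _.
rewrite -scalemxAl -scalemxAr !scalerA -fact_binomial.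
by rewrite -[_ *+ 'C(k, i)]scaler_nat scalerA.
Qed.

Lemma exp_coeffD (a b : R) k :
  exp_coeff (a + b) k = \sum_(i < k.+1) exp_coeff a (k - i)%N * exp_coeff b i.
Proof.
rewrite /exp_coeff /= exprDn mulr_suml; apply: eq_bigr => i _.
rewrite -mulr_natr [LHS](_ : _ = a ^+ (k - i) * b ^+ i * ((k`!%:R)^-1 * 'C(k, i)%:R)).
  by rewrite fact_binomial mulrACA.
by rewrite -[LHS]mulrA (mulrC 'C(k, i)%:R).
Qed.

(** The difference of the product of the partial sums of exp A and exp B and of the
    partial sum of exp (A + B) consists of the terms beyond the antidiagonal.
    It is dominated by the same expression for the norms of A and B, which tends
    to 0 because the real exponential is additive. *)
Lemma expmxD A B : A *m B = B *m A -> expmx (A + B) = expmx A *m expmx B.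
Proof.
move=> cAB; pose a := snorm A; pose b := snorm B.
have a0 : 0 <= a := snorm_ge0 A. have b0 : 0 <= b := snorm_ge0 B.
pose d m := series (exp_term A) m *m series (exp_term B) m -
  series (exp_term (A + B)) m.
pose e m := series (exp_coeff a) m * series (exp_coeff b) m -
  series (exp_coeff (a + b)) m.
have dl : d @ \oo --> expmx A *m expmx B - expmx (A + B).
  by apply: cvgB; [apply: cvg_mulmx; exact: cvg_expmx|exact: cvg_expmx].
have el : e @ \oo --> (0 : R).
  have -> : 0 = expR a * expR b - expR (a + b) by rewrite expRD subrr.
  by apply: cvgB; [apply: cvgM|]; exact: is_cvg_series_exp_coeff.
suff d0 : d @ \oo --> (0 : 'M[R]_n).
  apply/eqP; rewrite eq_sym -subr_eq0 -(cvg_lim (@norm_hausdorff R _) dl).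
  by apply/eqP; apply: cvg_lim d0; exact: norm_hausdorff.
apply/norm_cvg0P; apply: (@squeeze_cvgr _ _ _ _ (fun=> 0) e) => //; last exact: cvg_cst.
apply: nearW => m; rewrite normr_ge0 /=.
have -> : d m = \sum_(i < m) \sum_(m - i <= j < m) exp_term A j *m exp_term B i.
  rewrite -(square_sub_triangle (fun i j => exp_term A j *m exp_term B i)).
  rewrite exchange_big /d /series /= !big_mkord; congr (_ - _).
    by rewrite mulmx_suml; apply: eq_bigr => j _; rewrite mulmx_sumr.
  by apply: eq_bigr => k _; exact: exp_termD.
have -> : e m = \sum_(i < m) \sum_(m - i <= j < m) exp_coeff a j * exp_coeff b i.
  rewrite -(square_sub_triangle (fun i j => exp_coeff a j * exp_coeff b i)).
  rewrite exchange_big /e /series /= !big_mkord; congr (_ - _).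
    by rewrite mulr_suml; apply: eq_bigr => j _; rewrite mulr_sumr.
  by apply: eq_bigr => k _; exact: exp_coeffD.
rewrite (le_trans (ler_norm_sum _ _ _)) //; apply: ler_sum => i _.
rewrite (le_trans (ler_norm_sum _ _ _)) //; apply: ler_sum => j _.
rewrite /exp_term /exp_coeff /= -scalemxAl -scalemxAr scalerA normrZ ger0_norm //.
rewrite mulrACA -invfM [leRHS]mulrC invfM ler_wpM2l //.
exact: norm_mulX_snorm.
Qed.

Lemma expmx_mulN X : expmx X *m expmx (- X) = 1%:M.
Proof. by rewrite -expmxD ?subrr ?expmx0 // mulmxN mulNmx. Qed.

Lemma expmx_unit X : expmx X \in unitmx.
Proof. by have [] := mulmx1_unit (expmx_mulN X). Qed.

Lemma invmx_expmx X : invmx (expmx X) = expmx (- X).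
Proof. by rewrite -[LHS]mulmx1 -(expmx_mulN X) mulKmx // expmx_unit. Qed.

Lemma expmx_natmul X k : expmx (X *+ k) = expmx X ^+ k.
Proof.
elim: k => [|k IHk]; first by rewrite mulr0n expr0 expmx0.
have cX : X *m (X *+ k) = X *+ k *m X.
  by rewrite -scaler_nat -scalemxAl -scalemxAr.
by rewrite mulrS exprS (expmxD cX) IHk.
Qed.

End Exponential.

(** * Strict derivatives at the origin *)

Section StrictDerivative.
Variables (R : realType) (n : nat) (V : normedModType R).
Implicit Types (f g A B : V -> 'M[R]_n).

(** A is the strict derivative of f at 0. Boundedness of A is part of the notion
    because the product rule relies on it. *)
Definition strict_diff0 f A : Prop :=
  (exists K : R, forall x, `|A x| <= K * `|x|) /\
  forall e : R, 0 < e -> exists2 d : R, 0 < d & forall x y,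
    `|x| <= d -> `|y| <= d -> `|f x - f y - A (x - y)| <= e * `|x - y|.

Lemma strict_diff0_scaled f A (C : R) : (exists K : R, forall x, `|A x| <= K * `|x|) ->
  0 <= C -> (forall e : R, 0 < e -> exists2 d : R, 0 < d & forall x y,
    `|x| <= d -> `|y| <= d -> `|f x - f y - A (x - y)| <= C * e * `|x - y|) ->
  strict_diff0 f A.
Proof.
move=> Ab C0 fA; split=> // e e0.
have C1 : 0 < C + 1 by rewrite ltr_wpDl.
have [|d d0 fd] := fA (e / (C + 1)); first by rewrite divr_gt0.
exists d => // x y xd yd; apply: le_trans (fd x y xd yd) _.
rewrite ler_wpM2r // mulrCA ger_pMr // ler_pdivrMr // mul1r.
by rewrite lerDl.
Qed.

Lemma strict_diff0_cst X : strict_diff0 (fun=> X) (fun=> 0).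
Proof.
split; first by exists 0 => x; rewrite normr0 mul0r.
move=> e e0; exists 1 => // x y _ _.
by rewrite subrr subr0 normr0 mulr_ge0 // ltW.
Qed.

Lemma strict_diff0_lip f A : strict_diff0 f A -> exists2 C : R, 0 <= C &
  (forall x, `|A x| <= C * `|x|) /\
  exists2 d : R, 0 < d & forall x y, `|x| <= d -> `|y| <= d ->
    `|f x - f y| <= C * `|x - y|.
Proof.
move=> [[K AK] /(_ 1 ltr01)[d d0 fd]].
have K1 (x : V) : K * `|x| <= (`|K| + 1) * `|x|.
  by rewrite ler_wpM2r // (le_trans (ler_norm K)) // lerDl.
exists (`|K| + 1); first by rewrite addr_ge0.
split=> [x|]; first exact: le_trans (AK x) (K1 x).
exists d => // x y xd yd; rewrite -[f x - f y](subrK (A (x - y))).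
rewrite (le_trans (ler_normD _ _)) // addrC mulrDl lerD ?fd //.
by rewrite (le_trans (AK _)) // ler_wpM2r // ler_norm.
Qed.

Lemma strict_diff0_mul f g A B : strict_diff0 f A -> strict_diff0 g B ->
  strict_diff0 (fun x => f x *m g x) (fun x => A x *m g 0 + f 0 *m B x).
Proof.
move=> fA gB.
have [Cf Cf0 [ACf [df df0 fCf]]] := strict_diff0_lip fA.
have [Cg Cg0 [BCg [dg dg0 gCg]]] := strict_diff0_lip gB.
pose c : R := n.+1%:R.
have c0 : 0 <= c by [].
pose C := Cf + Cg + `|f 0| + `|g 0|.
have fC : Cf <= C by rewrite /C -!addrA lerDl !addr_ge0.
have gC : Cg <= C by rewrite /C addrAC -!addrA (addrCA Cf) lerDl !addr_ge0.
have f0C : `|f 0| <= C by rewrite /C addrAC lerDr !addr_ge0.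
have g0C : `|g 0| <= C by rewrite /C lerDr !addr_ge0.
have C0 : 0 <= C by rewrite !addr_ge0.
apply: (@strict_diff0_scaled _ _ (c * (4 * C + 2 * C ^+ 2))).
- exists (c * C * C + c * C * C) => x.
  rewrite mulrDl (le_trans (ler_normD _ _)) // lerD //.
    rewrite (le_trans (mx_norm_mul _ _)) // -!mulrA ler_wpM2l //.
    by rewrite mulrC ler_pM // (le_trans (ACf x)) // ler_wpM2r.
  rewrite (le_trans (mx_norm_mul _ _)) // -!mulrA ler_wpM2l // ler_pM //.
  by rewrite (le_trans (BCg x)) // ler_wpM2r.
- by rewrite mulr_ge0 // addr_ge0 // mulr_ge0 // exprn_ge0.
move=> e e0.
have [d1 d10 fe] := fA.2 e e0; have [d2 d20 ge] := gB.2 e e0.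
pose d := Num.min (Num.min df dg) (Num.min (Num.min d1 d2) (Num.min e 1)).
have d0 : 0 < d by rewrite !lt_min df0 dg0 d10 d20 e0 ltr01.
have := lexx d; rewrite {2}/d !le_min => /andP[/andP[ddf ddg]].
move=> /andP[/andP[dd1 dd2] /andP[de d1le]].
exists d => // x y xd yd; set h := x - y.
have nf0 z : `|z| <= d -> `|f z - f 0| <= C * e.
  move=> zd; rewrite (le_trans (fCf _ _ (le_trans zd ddf) _)) ?normr0 ?(ltW df0) //.
  by rewrite subr0 ler_pM // (le_trans zd).
have ng0 z : `|z| <= d -> `|g z - g 0| <= C * e.
  move=> zd; rewrite (le_trans (gCg _ _ (le_trans zd ddg) _)) ?normr0 ?(ltW dg0) //.
  by rewrite subr0 ler_pM // (le_trans zd).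
have nf z : `|z| <= d -> `|f z| <= 2 * C.
  move=> zd; rewrite -[f z](subrK (f 0)) (le_trans (ler_normD _ _)) //.
  rewrite mulr_natl mulr2n lerD //
    (le_trans (fCf _ _ (le_trans zd ddf) _)) ?normr0 ?(ltW df0) //.
  by rewrite subr0 -[C]mulr1 ler_pM // (le_trans zd).
have ng z : `|z| <= d -> `|g z| <= 2 * C.
  move=> zd; rewrite -[g z](subrK (g 0)) (le_trans (ler_normD _ _)) //.
  rewrite mulr_natl mulr2n lerD //
    (le_trans (gCg _ _ (le_trans zd ddg) _)) ?normr0 ?(ltW dg0) //.
  by rewrite subr0 -[C]mulr1 ler_pM // (le_trans zd).
have -> : f x *m g x - f y *m g y - (A h *m g 0 + f 0 *m B h) =
    (f x - f y - A h) *m g x + A h *m (g x - g 0) +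
    (f y *m (g x - g y - B h) + (f y - f 0) *m B h).
  rewrite !mulmxBr !mulmxBl.
  move: (f x *m _) (f y *m _) (f y *m _) (A h *m _) (A h *m _) (f y *m _) (f 0 *m _).
  by move=> *; apply/matrixP => i j; rewrite !mxE; ring.
have bnd (P Q : 'M[R]_n) p q : `|P| <= p -> `|Q| <= q -> `|P *m Q| <= c * p * q.
  move=> Pp Qq; rewrite (le_trans (mx_norm_mul _ _)) // -!mulrA ler_wpM2l //.
  by rewrite ler_pM.
have Ah : `|A h| <= C * `|h| by rewrite (le_trans (ACf _)) // ler_wpM2r.
have Bh : `|B h| <= C * `|h| by rewrite (le_trans (BCg _)) // ler_wpM2r.
have fh := fe x y (le_trans xd dd1) (le_trans yd dd1).
have gh := ge x y (le_trans xd dd2) (le_trans yd dd2).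
have t1 := bnd _ _ _ _ fh (ng x xd).
have t2 := bnd _ _ _ _ Ah (ng0 x xd).
have t3 := bnd _ _ _ _ (nf y yd) gh.
have t4 := bnd _ _ _ _ (nf0 y yd) Bh.
apply: le_trans (ler_normD _ _) _.
apply: le_trans (lerD (ler_normD _ _) (ler_normD _ _)) _.
apply: le_trans (lerD (lerD t1 t2) (lerD t3 t4)) _.
rewrite le_eqVlt; apply/orP; left; apply/eqP; rewrite -/h; ring.
Qed.

Lemma strict_diff0_expmx (l : V -> 'M[R]_n) (K : R) :
  (forall x y, l (x - y) = l x - l y) -> (forall x, `|l x| <= K * `|x|) ->
  strict_diff0 (fun x => expmx (l x)) l.
Proof.
move=> lB lK; pose c : R := n.+1%:R.
have c0 : 0 < c by [].
pose K1 := `|K| + 1.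
have K10 : 0 < K1 by rewrite ltr_wpDl.
have lK1 x : snorm (l x) <= c * K1 * `|x|.
  rewrite /snorm -mulrA ler_wpM2l // (le_trans (lK x)) // ler_wpM2r //.
  by rewrite (le_trans (ler_norm _)) // lerDl.
apply: (@strict_diff0_scaled _ _ (c * K1)); first by exists K.
  by rewrite mulr_ge0 ?ltW.
move=> e e0.
have e1 : 0 < 1 + e by rewrite addr_gt0.
(* This radius makes the constant expR r - 1 of the estimate equal to e. *)
pose r := ln (1 + e).
have r0 : 0 < r by rewrite ln_gt0 // ltrDl.
have re : expR r - 1 = e by rewrite lnK ?posrE // addrAC subrr add0r.
exists (r / (c * K1)); first by rewrite divr_gt0 // mulr_gt0.
move=> x y xd yd.
have lr z : `|z| <= r / (c * K1) -> snorm (l z) <= r.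
  by rewrite ler_pdivlMr ?mulr_gt0 // mulrC; exact: le_trans (lK1 z).
rewrite lB (le_trans (expmx_sub_id (lr x xd) (lr y yd))) // re -lB.
rewrite [leRHS](_ : _ = e * (c * K1 * `|x - y|)); last by ring.
by rewrite ler_wpM2l ?(ltW e0) ?lK1.
Qed.

Lemma strict_diff0_ext f g A B : f =1 g -> A =1 B ->
  strict_diff0 f A -> strict_diff0 g B.
Proof. by move=> /funext -> /funext ->. Qed.

(** Since every factor is 1 at the origin, the derivative of the product is the
    sum of the derivatives although the factors do not commute. *)
Lemma strict_diff0_prod (I : Type) (s : seq I) (F : I -> V -> 'M[R]_n)
    (D : I -> V -> 'M[R]_n) :
  (forall i, F i 0 = 1%:M) -> (forall i, strict_diff0 (F i) (D i)) ->
  strict_diff0 (fun x => \prod_(i <- s) F i x) (fun x => \sum_(i <- s) D i x).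
Proof.
move=> F0 FD; elim: s => [|a s IHs].
  apply: strict_diff0_ext (strict_diff0_cst 1%:M) => x; by rewrite big_nil.
apply: strict_diff0_ext (strict_diff0_mul (FD a) IHs) => x; rewrite big_cons //.
by rewrite F0 mul1mx big1 ?mulmx1.
Qed.

End StrictDerivative.

(** * Local surjectivity and Cartan's argument *)

(** This joins the completeness and the norm of matrices, as the Banach fixed
    point theorem requires. *)
HB.instance Definition _ (R : realType) (n : nat) := Complete.on 'M[R]_n.

Section LocalGroup.
Variables (R : realType) (n : nat).
Implicit Types (X Y g : 'M[R]_n) (G : set 'M[R]_n).

(** The surjectivity half of the inverse function theorem: solving Psi Y = g
    amounts to finding a fixed point of Y |-> Y + g - Psi Y, which is
    1/2-Lipschitz on a small ball. *)
Lemma strict_diff0_locally_onto (Psi : 'M[R]_n -> 'M[R]_n) (r : R) :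
  strict_diff0 Psi id -> 0 < r -> exists2 rho : R, 0 < rho & forall g,
    `|g - Psi 0| <= rho -> exists2 Y, `|Y| <= r & Psi Y = g.
Proof.
move=> [_ PsiD] r0; have [|d d0 Pd] := PsiD 2^-1; first by rewrite invr_gt0.
pose s := Num.min r d.
have s0 : 0 < s by rewrite lt_min r0.
exists (s / 2) => [|g gs]; first by rewrite divr_gt0.
pose T Y := Y + g - Psi Y.
have TE Y Z : T Y - T Z = - (Psi Y - Psi Z - (Y - Z)).
  by apply/matrixP => i j; rewrite !mxE; ring.
have ctr Y Z : `|Y| <= s -> `|Z| <= s -> `|T Y - T Z| <= 2^-1 * `|Y - Z|.
  move=> Ys Zs; rewrite TE normrN.
  by apply: Pd; [apply: le_trans Ys _|apply: le_trans Zs _]; rewrite ge_min lexx orbT.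
have T0 : T 0 = g - Psi 0 by rewrite /T add0r.
pose U : set 'M[R]_n := [set Y | `|Y| <= s].
have Tfun : {homo T : Y / U Y >-> U Y}.
  move=> Y /= Ys; rewrite /U /= -[T Y](subrK (T 0)).
  apply: le_trans (ler_normD _ _) _; rewrite [leRHS](splitr s).
  apply: lerD; last by rewrite T0.
  apply: le_trans (ctr _ _ Ys _) _; first by rewrite normr0 ltW.
  by rewrite subr0 mulrC ler_wpM2r // invr_ge0.
have [|||Y Ys YE] := @banach_fixed_point R 'M[R]_n _ (mkfun_fun Tfun).
- exists (2^-1)%:nng; split => /=; first by rewrite invf_lt1 // ltr1n.
  by move=> [Y Z] [/= Ys Zs]; exact: ctr.
- apply: (@closed_comp _ _ (fun Y : 'M[R]_n => `|Y|) [set x | x <= s]).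
    by move=> ? _; exact: norm_continuous.
  exact: closed_le.
- by exists 0; rewrite /U /= normr0 ltW.
exists Y; first by rewrite (le_trans Ys) // ge_min lexx.
have : Y = T Y by [].
move=> /(congr1 (fun Z => Z - Y + Psi Y)); rewrite subrr add0r => ->.
by rewrite /T addrAC subrK addrAC subrr add0r.
Qed.

Lemma closure_ballP (A : set 'M[R]_n) X :
  (forall e : R, 0 < e -> exists2 Y, A Y & `|X - Y| < e) -> closure A X.
Proof.
move=> h B /nbhs_ballP[e /= e0 eB]; have [Y AY XY] := h e e0.
by exists Y; split=> //; apply: eB; rewrite -ball_normE.
Qed.

(** The Heine-Borel theorem is applied to row vectors, and the unit ball of
    matrices is a continuous image of that of row vectors. *)
Lemma unit_ball_compact : compact [set X : 'M[R]_n | `|X| <= 1].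
Proof.
have cv : continuous (@vec_mx R n n).
  move=> v A /nbhs_ballP[e /= e0 eA]; apply/nbhs_ballP; exists e => //= w.
  rewrite -ball_normE /= => vw; apply: eA; rewrite -ball_normE /= -linearB.
  apply: le_lt_trans vw.
  by apply: mx_norm_le => // i j; rewrite mxE mx_norm_entry.
have := @continuous_compact _ _ (@vec_mx R n n) [set v | `|v| <= 1]
  (continuous_subspaceT cv).
set K := _ @` _ => /(_ _)cK.
have -> : [set X : 'M[R]_n | `|X| <= 1] = K.
  apply/seteqP; split => [X /= X1|_ [v /= v1 <-]].
    exists (mxvec X); last exact: mxvecK.
    apply: mx_norm_le => // i j; rewrite ord1; case/mxvec_indexP: j => a b.
    by rewrite mxvecE (le_trans (mx_norm_entry _ _ _)).
  by apply: mx_norm_le => // i j; rewrite mxE (le_trans (mx_norm_entry _ _ _)).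
apply: cK; apply: bounded_closed_compact.
  exists 1; split=> // x x1 v /= v1; exact: le_trans v1 (ltW x1).
apply: (@closed_comp _ _ (fun Y : 'rV[R]_(n * n) => `|Y|) [set x | x <= 1]).
  by move=> ? _; exact: norm_continuous.
exact: closed_le.
Qed.

(** If small m with exp m in G point in directions that tend to u, then the powers
    exp (p m) with p = floor (t / |m|) stay in G and tend to exp (t u), so that
    exp (t u) lies in G because G is closed. *)
Lemma closed_group_direction G (u : 'M[R]_n) : linear_lie_group G ->
  `|u| <= 1 ->
  (forall e : R, 0 < e -> exists2 m : 'M[R]_n, 0 < `|m| < e /\ G (expmx m) &
     `| (`|m|^-1) *: m - u| < e) ->
  lie_algebra G u.
Proof.
move=> [[GU G1 GM GV] Gcl] u1 appr.
have Gexp X : closure G (expmx X) -> G (expmx X).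
  by move=> GX; apply: Gcl; split=> //; exact: expmx_unit.
have GX m p : G (expmx m) -> G (expmx (m *+ p)).
  move=> Gm; rewrite expmx_natmul; elim: p => [|p IHp]; first by rewrite expr0.
  by rewrite exprS; apply: GM.
suff pos t : 0 <= t -> G (expmx (t *: u)).
  move=> t; have [|/ltW t0] := leP 0 t; first exact: pos.
  by rewrite -[t]opprK scaleNr -invmx_expmx; apply/GV/pos; rewrite oppr_ge0.
move=> t0; apply: Gexp; apply: closure_ballP => e e0.
pose c : R := n.+1%:R.
pose C := expR (c * t) * c * (1 + t).
have C0 : 0 < C by rewrite !mulr_gt0 ?expR_gt0 ?ltr_pwDl.
have [m [/andP[m0 me] Gm] mu] := appr _ (divr_gt0 e0 C0).
pose p := Num.truncn (t / `|m|).
have /andP[] := truncn_itv (divr_ge0 t0 (ltW m0)).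
rewrite -/p ler_pdivlMr // ltr_pdivrMr // => pt tp.
exists (expmx (m *+ p)); first exact: GX.
have mpE : m *+ p = (p%:R * `|m|) *: (`|m|^-1 *: m).
  by rewrite scalerA mulfK ?gt_eqF // scaler_nat.
have nmp : `|m *+ p| <= t by rewrite -scaler_nat normrZ ger0_norm.
have ntu : `|t *: u| <= t by rewrite normrZ ger0_norm // ler_piMr.
have sm X : `|X| <= t -> snorm X <= c * t by move=> Xt; rewrite ler_wpM2l.
rewrite (le_lt_trans (expmx_lip (sm _ ntu) (sm _ nmp))) //.
suff : `|t *: u - m *+ p| < e / C * (1 + t).
  rewrite /snorm mulrA => dlt.
  have cc : 0 < expR (c * t) * c by rewrite mulr_gt0 ?expR_gt0.
  rewrite -/c -(ltr_pM2l cc) in dlt; apply: lt_le_trans dlt _.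
  have t1 : 0 < 1 + t by rewrite ltr_pwDl.
  by rewrite mulrCA -/C divfK // gt_eqF.
have -> : t *: u - m *+ p =
    (t - p%:R * `|m|) *: (`|m|^-1 *: m) + t *: (u - `|m|^-1 *: m).
  by rewrite scalerBl -mpE scalerBr; apply/matrixP => i j; rewrite !mxE; ring.
rewrite (le_lt_trans (ler_normD _ _)) // !normrZ normfV normr_id mulVf ?gt_eqF //.
rewrite mulr1 mulrDr mulr1; apply: ltr_leD.
  rewrite ger0_norm ?subr_ge0 // (le_lt_trans _ me) // lerBlDr.
  by rewrite -[X in X + _]mul1r -mulrDl addrC natr1 ltW.
by rewrite (ger0_norm t0) distrC mulrC ler_wpM2r // ltW.
Qed.

(** The key step of Cartan's closed subgroup theorem. Otherwise there is a sequence
    of nonzero m in the kernel of pi tending to 0 with exp m in G. By compactness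
    their directions accumulate at a unit vector, which is in the kernel of pi,
    and in the Lie algebra by [closed_group_direction]. *)
Lemma exp_transversal_trivial G (pi : {linear 'M[R]_n -> 'M[R]_n}) :
  linear_lie_group G -> (forall X, lie_algebra G X -> pi X = 0 -> X = 0) ->
  exists2 d : R, 0 < d & forall m, pi m = 0 -> `|m| < d -> G (expmx m) -> m = 0.
Proof.
move=> Glin piG; apply: contrapT => nd.
have bad (k : nat) : exists m, [/\ pi m = 0, `|m| < k.+1%:R^-1, G (expmx m) & m != 0].
  apply: contrapT => nk; apply: nd; exists k.+1%:R^-1; first by rewrite invr_gt0.
  move=> m pm mk Gm; apply: contrapT => /eqP m0; apply: nk; exists m; split=> //.
have [m /all_and4[pm mk Gm m0]] := choice bad.
pose u k := `|m k|^-1 *: m k.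
have nu k : `|u k| = 1.
  by rewrite normrZ normfV normr_id mulVf // normr_eq0.
have [|v [/= v1 clv]] := @unit_ball_compact (u @ \oo) _.
  by exists 0%N => // k _ /=; rewrite nu.
have appr e : 0 < e -> exists2 k, `|m k| < e & `|u k - v| < e.
  move=> e0.
  have [|| _ [[k /= ke <-] /= uv]] :=
      clv (u @` [set k | k.+1%:R^-1 < e]) [set x | `|x - v| < e].
  - have : \forall k \near \oo, k.+1%:R^-1 < e := near_infty_natSinv_lt (PosNum e0).
    by apply: filterS => k ke; exists k.
  - apply/nbhs_ballP; exists e => // x; rewrite -ball_normE /= distrC.
    by [].
  by exists k => //; rewrite (lt_trans (mk k)).
have Lv : lie_algebra G v.
  apply: closed_group_direction => // e /appr[k mke uve].
  by exists (m k) => //; rewrite normr_gt0 m0.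
have pv : pi v = 0.
  have [K K0 piK] := mx_linear_bounded pi.
  apply/eqP; rewrite -normr_le0; apply/ler_addgt0Pl => e e0; rewrite addr0.
  have K1 : 0 < K + 1 by rewrite ltr_wpDl.
  have [k _ uv] := appr _ (divr_gt0 e0 K1).
  have -> : pi v = - pi (u k - v).
    by rewrite linearB linearZ /= pm scaler0 sub0r opprK.
  rewrite normrN (le_trans (piK _)) // (le_trans (ler_wpM2l K0 (ltW uv))) //.
  by rewrite mulrCA ger_pMr // ler_pdivrMr // mul1r lerDl.
have v0 := piG v Lv pv.
have [k _] := appr 1 ltr01.
by rewrite v0 subr0 nu ltxx.
Qed.

End LocalGroup.

(** * Regular functions and Zariski closure *)

Section RegularFunctions.
Variables (R : realType) (n : nat).
Implicit Types (X Y : 'M[R]_n) (f g : 'M[R]_n -> R) (S G : set 'M[R]_n).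

Definition mx_meval (p : mpoly.mpoly (n * n) R) X : R :=
  mpoly.meval (fun i => mxvec X 0 i) p.

(** The regular functions on GL_n, that is, the polynomials in the entries and the
    inverse of the determinant. They are needed because conjugation by g is not
    polynomial in g. *)
Inductive regular : ('M[R]_n -> R) -> Prop :=
| regular_cst c : regular (fun=> c)
| regular_entry i j : regular (fun X => X i j)
| regular_add f g : regular f -> regular g -> regular (fun X => f X + g X)
| regular_mul f g : regular f -> regular g -> regular (fun X => f X * g X)
| regular_inv_det : regular (fun X => (\det X)^-1).

Lemma regular_sum I (s : seq I) (P : pred I) (F : I -> 'M[R]_n -> R) :
  (forall i, regular (F i)) -> regular (fun X => \sum_(i <- s | P i) F i X).
Proof.
move=> rF; elim: s => [|a s IHs].
  by under eq_fun do rewrite big_nil; exact: regular_cst.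
under eq_fun do rewrite big_cons.
by case: (P a) => //; apply: regular_add.
Qed.

Lemma regular_prod I (s : seq I) (P : pred I) (F : I -> 'M[R]_n -> R) :
  (forall i, regular (F i)) -> regular (fun X => \prod_(i <- s | P i) F i X).
Proof.
move=> rF; elim: s => [|a s IHs].
  by under eq_fun do rewrite big_nil; exact: regular_cst.
under eq_fun do rewrite big_cons.
by case: (P a) => //; apply: regular_mul.
Qed.

Lemma regular_exp f k : regular f -> regular (fun X => f X ^+ k).
Proof.
move=> rf; elim: k => [|k IHk]; first exact: regular_cst.
by under eq_fun do rewrite exprS; apply: regular_mul.
Qed.

Definition regular_mx m p (F : 'M[R]_n -> 'M[R]_(m, p)) : Prop :=
  forall i j, regular (fun X => F X i j).

Lemma regular_mx_cst m p (B : 'M[R]_(m, p)) : regular_mx (fun=> B).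
Proof. by move=> i j; exact: regular_cst. Qed.

Lemma regular_mx_id : regular_mx id.
Proof. by move=> i j; exact: regular_entry. Qed.

Lemma regular_mx_mul m p q (F : 'M[R]_n -> 'M[R]_(m, p)) (H : 'M[R]_n -> 'M[R]_(p, q)) :
  regular_mx F -> regular_mx H -> regular_mx (fun X => F X *m H X).
Proof.
move=> rF rH i j; under eq_fun do rewrite mxE.
by apply: regular_sum => k; apply: regular_mul.
Qed.

Lemma regular_det m (F : 'M[R]_n -> 'M[R]_m) :
  regular_mx F -> regular (fun X => \det (F X)).
Proof.
move=> rF; apply: regular_sum => s.
by apply: regular_mul; [exact: regular_cst|apply: regular_prod => i; exact: rF].
Qed.

(** The inverse on GL_n, in a form which makes its entries regular everywhere. *)
Definition adj_inv X : 'M[R]_n := (\det X)^-1 *: \adj X.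

Lemma adj_invE X : X \in unitmx -> adj_inv X = invmx X.
Proof. by rewrite /invmx => ->. Qed.

Lemma regular_mx_inv : regular_mx adj_inv.
Proof.
move=> i j; under eq_fun do rewrite !mxE.
apply: regular_mul; first exact: regular_inv_det.
apply: regular_mul; first exact: regular_cst.
by apply: regular_det => a b; under eq_fun do rewrite !mxE; exact: regular_entry.
Qed.

Lemma regular_linear (f : {linear 'M[R]_n -> 'M[R]_n}) (F : 'M[R]_n -> 'M[R]_n) :
  regular_mx F -> regular_mx (fun X => f (F X)).
Proof.
move=> rF i j; have -> : (fun X => f (F X) i j) =
    fun X => \sum_a \sum_b F X a b * f (delta_mx a b) i j.
  apply/funext => X; rewrite {1}(matrix_sum_delta (F X)) linear_sum summxE.
  apply: eq_bigr => a _; rewrite linear_sum summxE; apply: eq_bigr => b _.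
  by rewrite linearZ mxE.
apply: regular_sum => a; apply: regular_sum => b.
by apply: regular_mul => //; exact: regular_cst.
Qed.

Lemma regular_meval (p : mpoly.mpoly (n * n) R) (F : 'M[R]_n -> 'M[R]_n) :
  regular_mx F -> regular (fun X => mx_meval p (F X)).
Proof.
move=> rF; under eq_fun do rewrite /mx_meval mpoly.mevalE.
apply: regular_sum => m; apply: regular_mul; first exact: regular_cst.
apply: regular_prod => k; apply: regular_exp.
by case/mxvec_indexP: k => i j; under eq_fun do rewrite mxvecE; exact: rF.
Qed.

Lemma mx_meval_det : exists p, forall X, mx_meval p X = \det X.
Proof.
exists (\det (\matrix_(i < n, j < n)
  mpoly.mpolyX R (mpoly.mnm1 (mxvec_index i j)))) => X.
rewrite /mx_meval -det_map_mx; congr (\det _).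
apply/matrixP => i j; rewrite !mxE /=.
by rewrite mpoly.mevalXU mxvecE.
Qed.

(** Clearing denominators: on GL_n, a regular function has the same zeros as a
    polynomial. *)
Lemma regular_poly f : regular f -> exists k p, forall X, X \in unitmx ->
  mx_meval p X = \det X ^+ k * f X.
Proof.
have [d dE] := mx_meval_det.
elim=> [c|i j|{}f g _ [k [p pE]] _ [l [q qE]]|{}f g _ [k [p pE]] _ [l [q qE]]|].
- by exists 0%N, (mpoly.mpolyC _ c) => X _; rewrite mul1r /mx_meval mpoly.mevalC.
- exists 0%N, (mpoly.mpolyX R (mpoly.mnm1 (mxvec_index i j))) => X _.
  by rewrite mul1r /mx_meval mpoly.mevalXU mxvecE.
- exists (k + l)%N, (d ^+ l * p + d ^+ k * q) => X XU.
  rewrite /mx_meval rmorphD !rmorphM !rmorphXn /= -!/(mx_meval _ X).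
  by rewrite dE pE // qE // exprD; ring.
- exists (k + l)%N, (p * q) => X XU.
  by rewrite /mx_meval rmorphM /= -!/(mx_meval _ X) pE // qE // exprD; ring.
- exists 1%N, 1 => X XU; rewrite /mx_meval rmorph1 expr1 mulfV //.
  by rewrite -unitfE -unitmxE.
Qed.

Lemma zariski_closureP S X : zariski_closure S X <->
  forall p, (forall Y, S Y -> mx_meval p Y = 0) -> mx_meval p X = 0.
Proof.
split=> [SX p Sp|Sp Z [[P ->] SZ] p Pp].
  apply: (SX [set Y | forall q, [set p] q -> mx_meval q Y = 0]) => //.
  split; first by exists [set p].
  by move=> Y SY q ->; exact: Sp.
by apply: Sp => Y /SZ /(_ p Pp).
Qed.

Lemma regular_closure S f X : S `<=` @GL R n -> regular f ->
  (forall Y, S Y -> f Y = 0) -> X \in unitmx -> zariski_closure S X -> f X = 0.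
Proof.
move=> SU /regular_poly[k [p pE]] Sf XU /zariski_closureP/(_ p) pX.
have /eqP : \det X ^+ k * f X = 0.
  by rewrite -pE // pX // => Y SY; rewrite pE ?Sf ?mulr0 //; exact: SU.
rewrite mulf_eq0 expf_eq0 => /orP[/andP[_ /eqP d0]|/eqP //].
by move: XU; rewrite unitmxE d0 unitr0.
Qed.

Lemma zariski_closure_sub S S' : S `<=` S' -> zariski_closure S `<=` zariski_closure S'.
Proof.
move=> SS' X /zariski_closureP SX; apply/zariski_closureP => p S'p.
by apply: SX => Y /SS'; exact: S'p.
Qed.

Lemma sub_zariski_closure S : S `<=` zariski_closure S.
Proof. by move=> X SX; apply/zariski_closureP => p; exact. Qed.

(** Maps with regular entries are continuous for the Zariski topology of GL_n. The
    regular map F' stands in for maps F such as the inverse, which are given by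
    regular functions only on GL_n. *)
Lemma zariski_closure_map S S' (F F' : 'M[R]_n -> 'M[R]_n) X :
  S `<=` @GL R n -> regular_mx F' -> (forall Y, Y \in unitmx -> F' Y = F Y) ->
  (forall Y, S Y -> zariski_closure S' (F Y)) -> X \in unitmx ->
  zariski_closure S X -> zariski_closure S' (F X).
Proof.
move=> SU rF F'F SF XU clX; apply/zariski_closureP => p S'p.
rewrite -F'F //.
apply: (@regular_closure S (fun Y => mx_meval p (F' Y))) => //.
  exact: regular_meval.
move=> Y SY; rewrite F'F; last exact: SU.
exact: (zariski_closureP _ _).1 (SF Y SY) p S'p.
Qed.

End RegularFunctions.

Section NormalSubgroups.
Variables (R : realType) (n : nat).
Implicit Types (G H N S : set 'M[R]_n).

(** For x in Gamma, conjugation by x preserves H, hence its closure. For fixed w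
    the condition on x is Zariski closed, so it passes from Gamma to G. *)
Lemma normal_closure_conj G Gamma H x w : G `<=` @GL R n ->
  zariski_dense Gamma G -> normal_subgroup H Gamma -> G x -> G w ->
  zariski_closure H w -> zariski_closure H (x *m w *m invmx x).
Proof.
move=> GU [GaG GGa] [[[HU _ _ _] HGa] Hn] Gx Gw Hw.
apply: (@zariski_closure_map _ _ Gamma H (fun y => y *m w *m invmx y)
    (fun y => y *m w *m adj_inv y)) (GU _ Gx) (GGa _ Gx).
- by move=> y /GaG/GU.
- apply: regular_mx_mul; last exact: regular_mx_inv.
  by apply: regular_mx_mul; [exact: regular_mx_id|exact: regular_mx_cst].
- by move=> y yU; rewrite adj_invE.
move=> y Gay; apply: (@zariski_closure_map _ _ H H (fun v => y *m v *m invmx y)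
    (fun v => y *m v *m invmx y)) (GU _ Gw) Hw => //.
- apply: regular_mx_mul; last exact: regular_mx_cst.
  by apply: regular_mx_mul; [exact: regular_mx_cst|exact: regular_mx_id].
- by move=> v Hv; apply: sub_zariski_closure; exact: Hn.
Qed.

(** Inside GL_n this is the intersection of G with the Zariski closure of a subgroup
    H of G, described so that it is visibly a group. *)
Definition closure_stabilizer G H : set 'M[R]_n :=
  [set g | G g /\ forall Y, G Y -> zariski_closure H Y <-> zariski_closure H (g *m Y)].

Lemma closure_stabilizer_normal G Gamma H : is_group G ->
  zariski_dense Gamma G -> normal_subgroup H Gamma ->
  normal_subgroup (closure_stabilizer G H) G.
Proof.
move=> Ggrp Gad Hn; have [GU G1 GM GV] := Ggrp.
have cj x w : G x -> G w ->
    zariski_closure H w <-> zariski_closure H (x *m w *m invmx x).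
  move=> Gx Gw; split; first exact: (normal_closure_conj GU Gad Hn Gx Gw).
  have Gxw : G (x *m w *m invmx x) by apply/GM; [apply/GM|apply/GV].
  move=> /(normal_closure_conj GU Gad Hn (GV _ Gx) Gxw).
  by rewrite invmxK !mulmxA mulVmx ?mul1mx ?mulmxKV //; exact: GU.
split; first split; first split.
- by move=> g [/GU].
- by split=> // Y GY; rewrite mul1mx.
- move=> g h [Gg gE] [Gh hE]; split=> [|Y GY]; first exact: GM.
  by rewrite -mulmxA; apply: iff_trans (hE Y GY) _; apply/gE/GM.
- move=> g [Gg gE]; split=> [|Y GY]; first exact: GV.
  have GY' : G (invmx g *m Y) by apply/GM => //; exact: GV.
  by apply: iff_sym; have := gE _ GY'; rewrite mulKVmx //; exact: GU.
- by move=> g [].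
move=> x g Gx [Gg gE]; split=> [|Y GY].
  by apply/GM; [apply/GM|apply/GV].
have xU : x \in unitmx := GU _ Gx.
have Gx' := GV _ Gx.
have GYx : G (invmx x *m Y *m x) by apply/GM => //; exact: GM.
have := cj _ _ Gx' GY; rewrite invmxK => E1; apply: iff_trans E1 _.
apply: iff_trans (gE _ GYx) _; apply: iff_trans (cj x _ Gx (GM _ _ Gg GYx)) _.
by rewrite !mulmxA mulmxK.
Qed.

Lemma sub_closure_stabilizer G H : is_group G -> subgroup H G ->
  H `<=` closure_stabilizer G H.
Proof.
move=> [GU G1 GM GV] [[HU H1 HM HV] HG].
have tr g Y : H g -> G Y -> zariski_closure H Y -> zariski_closure H (g *m Y).
  move=> Hg GY HY.
  apply: (@zariski_closure_map _ _ H H (mulmx g) (mulmx g)) (GU _ GY) HY => //.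
    by apply: regular_mx_mul; [exact: regular_mx_cst|exact: regular_mx_id].
  by move=> v Hv; apply: sub_zariski_closure; exact: HM.
move=> g Hg; split=> [|Y GY]; first exact: HG.
split; first exact: tr.
move=> /(tr (invmx g) _ (HV _ Hg) (GM _ _ (HG _ Hg) GY)).
by rewrite mulKmx //; exact: HU.
Qed.

Lemma normally_irreducible_dense G Gamma H : is_group G ->
  zariski_dense Gamma G -> normally_irreducible Gamma G ->
  normal_subgroup H Gamma -> H <> [set 1%:M] -> zariski_dense H G.
Proof.
move=> Ggrp Gad irr Hn H1; have [[Hgrp HGa] _] := Hn.
have HG : H `<=` G := subset_trans HGa Gad.1.
split=> // g Gg.
have KG : closure_stabilizer G H = G.
  apply: contrapT => KG; apply: H1.
  have K1 := irr _ (closure_stabilizer_normal Ggrp Gad Hn) KG.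
  apply/seteqP; split=> [h Hh|_ ->]; last by case: Hgrp.
  rewrite -K1; split; last exact: HGa.
  exact: (sub_closure_stabilizer Ggrp (conj Hgrp HG)).
have [_ /(_ 1%:M)] : closure_stabilizer G H g by rewrite KG.
rewrite mulmx1; case: Ggrp => _ G1 _ _ /(_ G1)[+ _]; apply.
by have [_ H1' _ _] := Hgrp; exact: sub_zariski_closure.
Qed.

End NormalSubgroups.

(** * Brackets of a semisimple Lie algebra *)

Section SemisimpleSpan.
Variables (R : realType) (n : nat).
Implicit Types (L V : {vspace 'M[R]_n}).

(** Adjoin elements of P outside the span of s until none is left; the dimension
    strictly increases at each step. *)
Lemma finite_span (P : set 'M[R]_n) : exists s : seq 'M[R]_n,
  {in s, forall x, P x} /\ forall x, P x -> x \in << s >>%VS.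
Proof.
suff ext k (s : seq 'M[R]_n) : (\dim {:'M[R]_n} - \dim << s >> <= k)%N ->
    {in s, forall x, P x} -> exists r : seq 'M[R]_n,
      {in r, forall x, P x} /\ forall x, P x -> x \in << r >>%VS.
  exact: (ext _ [::] (leqnn _)).
elim: k s => [|k IHk] s sk sP.
  exists s; split=> // x _.
  suff -> : << s >>%VS = fullv by rewrite memvf.
  by apply/eqP; rewrite eqEdim subvf -subn_eq0 -leqn0.
have [|] := pselect (forall x, P x -> x \in << s >>%VS); first by exists s.
move=> /existsNP[x /not_implyP[Px /negP xs]].
apply: (IHk (x :: s)); last first.
  by move=> y; rewrite inE => /predU1P[->|/sP].
have lt : (\dim << s >> < \dim << x :: s>>)%N.
  rewrite ltnNge; apply: contra xs => le.
  have /eqP -> : << s >>%VS == << x :: s>>%VS.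
    by rewrite eqEdim le andbT span_cons addvSr.
  by rewrite memv_span // inE eqxx.
rewrite leq_subLR; rewrite leq_subLR in sk.
by rewrite (leq_trans sk) // addnS -addSn leq_add2r.
Qed.

(** The intersection of V with a simple ideal I is an ideal of I. It is nonzero since
    it contains the brackets of I, which is not abelian, so it is I. *)
Lemma semisimple_sub_brackets L V : lie_semisimple L ->
  (forall X Y, X \in L -> Y \in L -> lie_bracket X Y \in V) -> (L <= V)%VS.
Proof.
move=> [k [I [LE _ Isimple]]] LV; rewrite LE; apply/subv_sumP => i _.
have [[IL Iid] [nab Isim]] := Isimple i.
have [|I0|<-] := Isim (I i :&: V)%VS; last exact: capvSr.
  split=> [|X Y XI]; first exact: capvSl.
  rewrite !memv_cap => /andP[YI _]; rewrite Iid ?(subvP IL) //=.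
  by rewrite LV // (subvP IL).
case: nab => X Y XI YI; apply/eqP; rewrite -memv0 -I0 memv_cap.
by rewrite Iid ?(subvP IL) //= LV // (subvP IL).
Qed.

End SemisimpleSpan.

Section CommutatorCurves.
Variables (R : realType) (n : nat).
Implicit Types (X Y h : 'M[R]_n).

Lemma strict_diff0_commutator (V : normedModType R) (t : V -> R) (K : R) X h :
  (forall x y, t (x - y) = t x - t y) -> (forall x, `|t x| <= K * `|x|) ->
  h \in unitmx ->
  strict_diff0 (fun x => expmx (t x *: X) *m (h *m expmx (- (t x *: X)) *m invmx h))
    (fun x => t x *: (X - h *m X *m invmx h)).
Proof.
move=> tB tK hU.
have t0 : t 0 = 0 by rewrite -[0 in LHS](subrr 0) tB subrr.
have tX x : `|t x *: X| <= K * `|X| * `|x|.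
  by rewrite normrZ mulrAC ler_wpM2r.
have D1 : strict_diff0 (fun x => expmx (t x *: X)) (fun x => t x *: X).
  by apply: strict_diff0_expmx tX => x y; rewrite tB scalerBl.
have D2 : strict_diff0 (fun x => expmx (- (t x *: X))) (fun x => - (t x *: X)).
  apply: (@strict_diff0_expmx _ _ _ _ (K * `|X|)) => [x y|x]; last by rewrite normrN.
  by rewrite tB scalerBl opprD.
have D3 := strict_diff0_mul (strict_diff0_mul (strict_diff0_cst V h) D2)
  (strict_diff0_cst V (invmx h)).
have := strict_diff0_mul D1 D3; apply: strict_diff0_ext => // x.
rewrite t0 scale0r oppr0 expmx0 !mulmx1 !mul1mx mulmxV // mulmx0 addr0 add0r mulmx1.
by rewrite mulmxN mulNmx -scalemxAr -scalemxAl -scalerBr.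
Qed.

(** The difference quotients of f at 0 lie in the kernel of pi, which is closed. *)
Lemma strict_diff0_vanish (f A : R^o -> 'M[R]_n) (pi : {linear 'M[R]_n -> 'M[R]_n}) :
  strict_diff0 f A -> (forall t a : R, A (t *: a) = t *: A a) ->
  (forall t, pi (f t - f 0) = 0) -> pi (A 1) = 0.
Proof.
move=> [_ fA] AZ pif; have [K K0 piK] := mx_linear_bounded pi.
apply/eqP; rewrite -normr_le0; apply/ler_addgt0Pl => e e0; rewrite addr0.
have K1 : 0 < K + 1 by rewrite ltr_wpDl.
(* A single pair of points, at distance d, is enough as A is homogeneous. *)
have [d d0 /(_ d 0)] := fA (e / (K + 1)) (divr_gt0 e0 K1).
rewrite subr0 normr0 (gtr0_norm d0) lexx ltW // => /(_ isT isT) De.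
have := le_trans (piK _) (ler_wpM2l K0 De).
rewrite linearB pif sub0r normrN -[d in A d]mulr1 AZ linearZ normrZ gtr0_norm //.
rewrite mulrA mulrC ler_pM2r // => /le_trans; apply.
by rewrite mulrCA ger_pMr // ler_pdivrMr // mul1r lerDl.
Qed.

(** The bracket [Y, X] is the velocity at 0 of exp (t Y) X exp (- t Y). *)
Lemma lie_bracket_ker (pi : {linear 'M[R]_n -> 'M[R]_n}) X Y :
  (forall t : R, pi (X - expmx (t *: Y) *m X *m invmx (expmx (t *: Y))) = 0) ->
  pi (lie_bracket Y X) = 0.
Proof.
move=> piX.
have tY (x : R^o) : `|x *: Y| <= `|Y| * `|x| by rewrite normrZ mulrC.
have D1 : strict_diff0 (fun x : R^o => expmx (x *: Y)) (fun x => x *: Y).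
  by apply: strict_diff0_expmx tY => x y; rewrite scalerBl.
have D2 : strict_diff0 (fun x : R^o => expmx (- (x *: Y))) (fun x => - (x *: Y)).
  apply: (@strict_diff0_expmx _ _ _ _ `|Y|) => [x y|x]; last by rewrite normrN.
  by rewrite scalerBl opprD.
have D : strict_diff0 (fun x : R^o => expmx (x *: Y) *m X *m expmx (- (x *: Y)))
    (fun x => x *: lie_bracket Y X).
  have := strict_diff0_mul (strict_diff0_mul D1 (strict_diff0_cst R^o X)) D2.
  apply: strict_diff0_ext => // x.
  rewrite !scale0r oppr0 expmx0 !mulmx1 !mul1mx addr0.
  by rewrite mulmxN -scalemxAl -scalemxAr -scalerBr.
rewrite -[lie_bracket Y X]scale1r; apply: (strict_diff0_vanish D) => [t a|t].
  by rewrite scalerA.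
rewrite scale0r oppr0 expmx0 mulmx1 mul1mx -opprB linearN -invmx_expmx piX.
by rewrite oppr0.
Qed.

End CommutatorCurves.

Section OpenNormalSubgroup.
Variables (R : realType) (n : nat).
Implicit Types (G N : set 'M[R]_n) (L : {vspace 'M[R]_n}).

Definition proj_compl L X : 'M[R]_n := X - projv L X.

Lemma proj_compl_linear L : linear (proj_compl L).
Proof. by move=> a X Y; rewrite /proj_compl linearD linearZ scalerBr opprD addrACA. Qed.

HB.instance Definition _ L :=
  GRing.isLinear.Build R _ _ _ (proj_compl L) (@proj_compl_linear L).

Lemma proj_compl_eq0 L X : (proj_compl L X == 0) = (X \in L).
Proof.
rewrite subr_eq0; apply/eqP/idP => [->|XL]; first exact: memv_proj.
by rewrite projv_id.
Qed.


(** The condition that X - g X g^-1 lies in V is Zariski closed in g and holds on N,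
    hence on G; its derivative along exp (t Y) puts the brackets of L in V. *)
Lemma dense_normal_span G N L : linear_lie_group G -> lie_algebra G = [set` L] ->
  lie_semisimple L -> normal_subgroup N G -> zariski_dense N G ->
  forall V : {vspace 'M[R]_n},
  (forall X h, X \in L -> N h -> X - h *m X *m invmx h \in V) -> (L <= V)%VS.
Proof.
move=> [[GU _ _ _] _] LE Lss [[[NU _ _ _] NG] _] [_ GN] V NV.
apply: (semisimple_sub_brackets Lss) => Y X YL XL.
have GV g : G g -> X - g *m X *m invmx g \in V.
  move=> Gg; rewrite -proj_compl_eq0; apply/eqP/matrixP => i j; rewrite [RHS]mxE.
  pose f g : 'M[R]_n := proj_compl V (X - g *m X *m adj_inv g).
  have fE h : h \in unitmx -> f h = proj_compl V (X - h *m X *m invmx h).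
    by move=> hU; rewrite /f adj_invE.
  rewrite -fE; last exact: GU.
  apply: (@regular_closure _ _ N (fun g => f g i j)) => //.
  - apply: regular_linear => a b; under eq_fun do rewrite mxE [X in _ + X]mxE -mulN1r.
    apply: regular_add; first exact: regular_cst.
    apply: regular_mul; first exact: regular_cst.
    apply: regular_mx_mul; last exact: regular_mx_inv.
    by apply: regular_mx_mul; [exact: regular_mx_id|exact: regular_mx_cst].
  - move=> h Nh; rewrite fE; last exact: NU.
    by have /eqP -> : proj_compl V (X - h *m X *m invmx h) == 0;
      rewrite ?mxE ?proj_compl_eq0 ?NV.
  - exact: GU.
  - exact: GN.
rewrite -proj_compl_eq0; apply/eqP; apply: lie_bracket_ker => t.
apply/eqP; rewrite proj_compl_eq0; apply: GV.
by have : lie_algebra G Y by rewrite LE.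
Qed.

End OpenNormalSubgroup.

(** * Dense normal subgroups *)

Section Conclusion.
Variables (R : realType) (n : nat).
Implicit Types (G N : set 'M[R]_n) (L : {vspace 'M[R]_n}).

Lemma open_translate (h : 'M[R]_n) (rho : R) :
  open [set X : 'M[R]_n | `|h *m X - 1%:M| < rho].
Proof.
rewrite openE => X /= Xrho; apply/nbhs_ballP.
have [K K0 hK] := mx_linear_bounded (mulmx h).
have K1 : 0 < K + 1 by rewrite ltr_wpDl.
exists ((rho - `|h *m X - 1%:M|) / (K + 1)); first by rewrite /= divr_gt0 ?subr_gt0.
move=> Y; rewrite -ball_normE /= distrC ltr_pdivlMr // => XY.
have -> : h *m Y - 1%:M = h *m X - 1%:M + h *m (Y - X).
  by rewrite mulmxBr; apply/matrixP => i j; rewrite !mxE; ring.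
rewrite (le_lt_trans (ler_normD _ _)) // addrC -ltrBrDr (le_lt_trans _ XY) //.
rewrite (le_trans (hK _)) // mulrC ler_wpM2l //.
by rewrite lerDl.
Qed.

(** N is a union of translates of a neighbourhood of 1, and so is its complement in G;
    hence N is open and closed in G. *)
Lemma connected_open_subgroup G N (rho : R) : is_group G -> connected G ->
  subgroup N G -> 0 < rho -> (forall g, G g -> `|g - 1%:M| < rho -> N g) -> N = G.
Proof.
move=> [GU G1 GM GV] Gconn [[NU N1 NM NV] NG] rho0 Nrho.
pose O (S : set 'M[R]_n) :=
  \bigcup_(h in S) [set X : 'M[R]_n | `|invmx h *m X - 1%:M| < rho].
have Oopen S : open (O S) by apply: bigcup_open => h _; exact: open_translate.
have OS S X : S `<=` @GL R n -> S X -> O S X.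
  by move=> SU SX; exists X; rewrite //= mulVmx ?subrr ?normr0 //; exact: SU.
have trN h X : G h -> G X -> `|invmx h *m X - 1%:M| < rho -> N (invmx h *m X).
  by move=> Gh GX; apply: Nrho; apply/GM => //; exact: GV.
apply: Gconn.
- by exists 1%:M.
- exists (O N) => //; apply/seteqP; split=> X.
    by move=> NX; split; [exact: NG|exact: OS].
  move=> [GX [h Nh /= /(trN _ _ (NG _ Nh) GX) Nhx]].
  by rewrite -[X](mulKVmx (NU _ Nh)); apply/NM.
exists (~` O (G `\` N)); first exact: open_closedC.
apply/seteqP; split=> X.
  move=> NX; split=> [|[h [Gh nNh] /= /(trN _ _ Gh (NG _ NX)) NhX]]; first exact: NG.
  apply: nNh; have -> : h = X *m invmx (invmx h *m X).
    apply: (can_inj (mulmxK (NU _ NhX))).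
    by rewrite mulmxKV ?(NU _ NhX) // mulKVmx //; exact: GU.
  by apply/NM => //; exact: NV.
move=> [GX nOX]; apply: contrapT => nNX; apply: nOX; apply: OS => //.
by move=> Y [/GU].
Qed.

(** The map Psi below is a product of commutator curves in N, whose velocities span L,
    followed by the exponential on a complement of L. Its derivative at 0 is the
    identity, so each g in G near 1 is Psi Y for a small Y, and the factor of
    Psi Y transverse to L is trivial. *)
Lemma dense_normal_nbhs_id G N : linear_lie_group G -> semisimple_lie_group G ->
  normal_subgroup N G -> zariski_dense N G ->
  exists2 rho : R, 0 < rho & forall g, G g -> `|g - 1%:M| < rho -> N g.
Proof.
move=> Glin [L [LE Lss]] Nn Nd.
have LG X : (X \in L) = `[< lie_algebra G X >] by rewrite LE; apply/idP/asboolP.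
have [[GU G1 GM GV] _] := Glin.
have [[[NU N1 NM NV] NG] NJ] := Nn.
have [s [sP sS]] := finite_span [set v | exists Xh : 'M[R]_n * 'M[R]_n,
  [/\ Xh.1 \in L, N Xh.2 & v = Xh.1 - Xh.2 *m Xh.1 *m invmx Xh.2]].
have Ls : (L <= << s >>)%VS.
  apply: (dense_normal_span Glin LE Lss Nn Nd) => X h XL Nh.
  by apply: sS; exists (X, h).
have /choice[Xh /all_and3[XL Nh sE]] : forall i : 'I_(size s),
    exists Xh : 'M[R]_n * 'M[R]_n,
    [/\ Xh.1 \in L, N Xh.2 & s`_i = Xh.1 - Xh.2 *m Xh.1 *m invmx Xh.2].
  by move=> i; apply: sP; exact: mem_nth.
pose t i : {linear 'M[R]_n -> R^o} := coord (in_tuple s) i \o projv L.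
pose F i (Y : 'M[R]_n) := expmx (t i Y *: (Xh i).1) *m
  ((Xh i).2 *m expmx (- (t i Y *: (Xh i).1)) *m invmx (Xh i).2).
(* The coordinates t of the projection of Y on L govern the curves in N, and the
   complementary component of Y goes into the last factor. *)
pose Psi (Y : 'M[R]_n) := (\prod_i F i Y) *m expmx (proj_compl L Y).
have F0 i : F i 0 = 1%:M.
  by rewrite /F linear0 scale0r oppr0 expmx0 mulmx1 mul1mx mulmxV // NU.
have FN i Y : N (F i Y).
  have GE : G (expmx (t i Y *: (Xh i).1)).
    by have := XL i; rewrite LG => /asboolP; exact.
  rewrite /F -invmx_expmx !mulmxA; apply/NM; last exact: NV.
  exact: NJ.
have prodN Y : N (\prod_i F i Y).
  by elim/big_ind: _ => // x y Nx Ny; exact: NM.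
have [K K0 mK] := mx_linear_bounded (proj_compl L).
have Dm : strict_diff0 (fun Y => expmx (proj_compl L Y)) (proj_compl L).
  by apply: strict_diff0_expmx mK => x y; exact: linearB.
have DF i : strict_diff0 (F i) (fun Y => t i Y *: s`_i).
  have [Kt _ tK] := mx_linear_bounded (t i).
  rewrite sE; apply: strict_diff0_commutator tK _; last exact: NU.
  by move=> x y; exact: linearB.
have Psi0 : Psi 0 = 1%:M by rewrite /Psi linear0 expmx0 mulmx1 big1.
have DPsi : strict_diff0 Psi id.
  have := strict_diff0_mul (strict_diff0_prod (index_enum _) F0 DF) Dm.
  apply: strict_diff0_ext => // Y.
  have prod1 : \prod_i F i 0 = 1%:M by apply: big1.
  rewrite linear0 expmx0 mulmx1 prod1 mul1mx.
  rewrite -[RHS](subrK (projv L Y)) addrC; congr (_ + _).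
  by apply/esym; exact: (@coord_span _ _ _ (in_tuple s) _ (subvP Ls _ (memv_proj L Y))).
have [|d d0 Gd] := @exp_transversal_trivial _ _ _ (projv L) Glin.
  move=> X GX; rewrite /= projv_id //; by rewrite LG; apply/asboolP.
have K1 : 0 < K + 1 by rewrite ltr_wpDl.
have r0 : 0 < d / 2 / (K + 1) by rewrite !divr_gt0.
have [rho rho0 onto] := strict_diff0_locally_onto DPsi r0.
exists rho => // g Gg grho.
have [|Y Yr Yg] := onto g; first by rewrite Psi0 ltW.
have m0 : proj_compl L Y = 0.
  apply: Gd.
  - by rewrite /proj_compl linearB /= [X in _ - X]projv_id ?memv_proj ?subrr.
  - rewrite (le_lt_trans (mK _)) //.
    apply: (@le_lt_trans _ _ ((K + 1) * (d / 2 / (K + 1)))).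
      by rewrite ler_pM // lerDl.
    by rewrite mulrC divfK ?gt_eqF // ltr_pdivrMr // ltr_pMr // ltr1n.
  have -> : expmx (proj_compl L Y) = invmx (\prod_i F i Y) *m g.
    by rewrite -Yg /Psi mulKmx //; exact: NU.
  by apply/GM => //; apply/GV/NG.
by rewrite -Yg /Psi m0 expmx0 mulmx1.
Qed.

Lemma dense_normal_full G N : linear_lie_group G -> connected G ->
  semisimple_lie_group G -> normal_subgroup N G -> zariski_dense N G -> N = G.
Proof.
move=> Glin Gconn Gss Nn Nd.
have [rho rho0 Nrho] := dense_normal_nbhs_id Glin Gss Nn Nd.
exact: connected_open_subgroup Glin.1 Gconn Nn.1 rho0 Nrho.
Qed.

Lemma normal_subgroup_setI G Gamma N : subgroup Gamma G -> normal_subgroup N G ->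
  normal_subgroup (N `&` Gamma) Gamma.
Proof.
move=> [[GaU Ga1 GaM GaV] GaG] [[[NU N1 NM NV] NG] NJ].
split; first split; first split.
- by move=> X [/NU].
- by split.
- by move=> X Y [NX GaX] [NY GaY]; split; [exact: NM|exact: GaM].
- by move=> X [NX GaX]; split; [exact: NV|exact: GaV].
- by move=> X [].
move=> X Y GaX [NY GaY]; split; first by apply: NJ => //; exact: GaG.
by apply/GaM; [exact: GaM|exact: GaV].
Qed.

End Conclusion.

Theorem proposition3p7 (R : realType) (n : nat) (G Gamma : set 'M[R]_n)
    (G_linear : linear_lie_group G) (G_connected : connected G)
    (G_semisimple : semisimple_lie_group G)
    (Gamma_subgroup : subgroup Gamma G)
    (Gamma_dense : zariski_dense Gamma G) :
  (forall Gamma' : set 'M[R]_n,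
     normal_subgroup Gamma' Gamma -> Gamma' <> [set 1%:M] ->
     zariski_dense Gamma' G) <->
  normally_irreducible Gamma G.
Proof.
split=> [dense N Nn NG|irr H Hn H1]; last first.
  exact: normally_irreducible_dense G_linear.1 Gamma_dense irr Hn H1.
apply: contrapT => N1; apply: NG; apply: dense_normal_full => //.
have [_ GNGa] := dense _ (normal_subgroup_setI Gamma_subgroup Nn) N1.
split; first exact: Nn.1.2.
by move=> g /GNGa; apply: zariski_closure_sub => X [].
Qed.
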